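(* Let $R$ be a commutative ring with $1$ and $M$ an $R$-module. The sequence $$I_2\otimes M\xrightarrow{\ \chi\ }P^2_R(M)\xrightarrow{\ g_2\ }\Gamma^2_R(M)\to0$$ is exact, where $\chi$ is the $R$-linear map with $\chi((r^2-r)\otimes m)=p(rm)-r^2p(m)$ and $g_2$ is the $R$-linear map with $g_2(p(m))=\gamma_2(m)$ ($r\in R$, $m\in M$).
   Context: $\otimes$ means $\otimes_R$. $I_2$ is the ideal of $R$ generated by the elements $r^2-r$, $r\in R$. $P^2_R(M)$ is the $R$-module generated by elements $p(x)$, $x\in M$, subject to the relations, for $x,y,z\in M$, $r,s\in R$: $p(x+y+z)-p(x+y)-p(y+z)-p(x+z)+p(x)+p(y)+p(z)=0$; $p(rx+sy)-p(rx)-p(sy)-rs\,p(x+y)+rs\,p(x)+rs\,p(y)=0$; $p(rsx)-r^2p(sx)-s\,p(rx)+r^2s\,p(x)=0$. $\Gamma^2_R(M)$ is the degree $2$ component of the divided power algebra: the $R$-module generated by $\gamma_2(x)$ and symbols $\gamma_1(x)\gamma_1(y)$, $R$-bilinear in $x,y\in M$, with $\gamma_2(x+y)=\gamma_2(x)+\gamma_2(y)+\gamma_1(x)\gamma_1(y)$, $\gamma_2(rx)=r^2\gamma_2(x)$. The maps $\chi$ and $g_2$ are well defined by the given formulas. *)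

(* Defs.v *)
From HB Require Import structures.
From mathcomp Require Import all_boot all_algebra ring.
From mathcomp Require Import mathcomp_extra boolp classical_sets functions.
From mathcomp Require Import cardinality fsbigop.

Set Implicit Arguments.
Unset Strict Implicit.
Unset Printing Implicit Defensive.
Import GRing.Theory.
Local Open Scope classical_set_scope.
Local Open Scope ring_scope.
Local Open Scope quotient_scope.

Section Span.
Variables (R : pzRingType) (V : lmodType R).

Definition is_submodule (W : set V) :=
  W 0 /\ forall a u v, W u -> W v -> W (a *: u + v).

Definition span (S : set V) : set V := smallest is_submodule S.

Lemma span_is_submodule S : is_submodule (span S).
Proof.
split=> [|a u v Su Sv W [[W0 WD] SW]]; first by move=> W [[]].
exact: WD (Su _ (conj (conj W0 WD) SW)) (Sv _ (conj (conj W0 WD) SW)).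
Qed.

Lemma sub_span S : S `<=` span S.
Proof. by move=> v Sv W [_]; apply. Qed.

Lemma span_min S W : is_submodule W -> S `<=` W -> span S `<=` W.
Proof. by move=> Wm SW v; apply. Qed.

Lemma span0 S : span S 0.
Proof. by case: (span_is_submodule S). Qed.

Lemma spanP S a u v : span S u -> span S v -> span S (a *: u + v).
Proof. by case: (span_is_submodule S) => _; apply. Qed.

Lemma spanZ S a u : span S u -> span S (a *: u).
Proof. by move=> Su; rewrite -[_ *: _]addr0; apply: spanP => //; apply: span0. Qed.

Lemma spanD S u v : span S u -> span S v -> span S (u + v).
Proof. by move=> Su Sv; rewrite -[u]scale1r; apply: spanP. Qed.

Lemma spanN S u : span S u -> span S (- u).
Proof. by move=> Su; rewrite -scaleN1r; apply: spanZ. Qed.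

End Span.

Section Quotient.
Variables (R : pzRingType) (V : lmodType R) (S : set V).

Definition span_equiv (u v : V) : bool := `[< span S (u - v) >].

Lemma span_equiv_refl : reflexive span_equiv.
Proof. by move=> u; apply/asboolP; rewrite subrr; apply: span0. Qed.

Lemma span_equiv_sym : symmetric span_equiv.
Proof.
by move=> u v; apply/asboolP/asboolP => /spanN; rewrite opprB.
Qed.

Lemma span_equiv_trans : transitive span_equiv.
Proof.
move=> v u w /asboolP uv /asboolP vw; apply/asboolP.
by rewrite -(subrKA v); apply: spanD.
Qed.

Canonical span_equiv_rel :=
  EquivRel span_equiv span_equiv_refl span_equiv_sym span_equiv_trans.

(* V modulo the submodule generated by S *)
Definition quot := {eq_quot span_equiv}.
HB.instance Definition _ := Choice.on quot.
HB.instance Definition _ := EqQuotient.on quot.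

Definition qproj (v : V) : quot := \pi_quot v.

Lemma qproj_eq u v : qproj u = qproj v <-> span S (u - v).
Proof.
by split=> [/eqmodP/asboolP //|H]; apply/eqmodP/asboolP.
Qed.

Lemma qprojK (q : quot) : qproj (repr q) = q.
Proof. exact: reprK. Qed.

Definition quot_add (p q : quot) := qproj (repr p + repr q).
Definition quot_opp (p : quot) := qproj (- repr p).
Definition quot_scale a (p : quot) := qproj (a *: repr p).

Lemma span_repr v : span S (repr (qproj v) - v).
Proof. by apply/qproj_eq; rewrite qprojK. Qed.

Lemma quot_addE u v : quot_add (qproj u) (qproj v) = qproj (u + v).
Proof.
apply/qproj_eq; rewrite opprD addrACA.
by apply: spanD; apply: span_repr.
Qed.

Lemma quot_oppE u : quot_opp (qproj u) = qproj (- u).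
Proof. by apply/qproj_eq; rewrite -opprD; apply: spanN; apply: span_repr. Qed.

Lemma quot_scaleE a u : quot_scale a (qproj u) = qproj (a *: u).
Proof. by apply/qproj_eq; rewrite -scalerBr; apply: spanZ; apply: span_repr. Qed.

Fact quot_addA : associative quot_add.
Proof.
move=> p q r; rewrite -(qprojK p) -(qprojK q) -(qprojK r).
by rewrite !quot_addE addrA.
Qed.
Fact quot_addC : commutative quot_add.
Proof. by move=> p q; rewrite /quot_add addrC. Qed.
Fact quot_add0 : left_id (qproj 0) quot_add.
Proof. by move=> p; rewrite -(qprojK p) quot_addE add0r. Qed.
Fact quot_addN : left_inverse (qproj 0) quot_opp quot_add.
Proof. by move=> p; rewrite -(qprojK p) quot_oppE quot_addE addNr. Qed.

HB.instance Definition _ :=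
  GRing.isZmodule.Build quot quot_addA quot_addC quot_add0 quot_addN.

Fact quot_scaleA a b p : quot_scale a (quot_scale b p) = quot_scale (a * b) p.
Proof. by rewrite -(qprojK p) !quot_scaleE scalerA. Qed.
Fact quot_scale1 : left_id 1 quot_scale.
Proof. by move=> p; rewrite -(qprojK p) quot_scaleE scale1r. Qed.
Fact quot_scaleDr : right_distributive quot_scale +%R.
Proof.
move=> a p q; rewrite -(qprojK p) -(qprojK q).
by rewrite [_ + _]quot_addE !quot_scaleE [RHS]quot_addE scalerDr.
Qed.
Fact quot_scaleDl p : {morph quot_scale^~ p : a b / a + b}.
Proof.
move=> a b; rewrite -(qprojK p).
by rewrite !quot_scaleE [RHS]quot_addE scalerDl.
Qed.

HB.instance Definition _ := GRing.Zmodule_isLmodule.Build R quot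
  quot_scaleA quot_scale1 quot_scaleDr quot_scaleDl.

Fact qproj_is_linear : linear qproj.
Proof.
move=> a u v; rewrite -[RHS]/(quot_add (quot_scale a (qproj u)) (qproj v)).
by rewrite quot_scaleE quot_addE.
Qed.

End Quotient.

HB.instance Definition _ (R : pzRingType) (V : lmodType R) (S : set V) :=
  GRing.isLinear.Build R V (quot S) *:%R (@qproj R V S) (@qproj_is_linear R V S).

(* keeps unification from looking inside the quotient operations *)
#[global] Opaque quot_add quot_opp quot_scale qproj.

Section QuotientLift.
Variables (R : pzRingType) (V N : lmodType R) (S : set V).
Variables (f : {linear V -> N}) (f0 : forall v, S v -> f v = 0).

Definition quot_lift of (forall v, S v -> f v = 0) : quot S -> N :=
  fun q => f (repr q).

Lemma span_ker v : span S v -> f v = 0.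
Proof.
move: v; apply: (@span_min _ _ S [set v | f v = 0]) => [|v /f0 //].
split=> [|a u v /= fu fv]; first exact: linear0.
by rewrite linearP fu fv scaler0 addr0.
Qed.

Lemma quot_liftE v : quot_lift f0 (qproj S v) = f v.
Proof.
by apply/eqP; rewrite -subr_eq0 -linearB; apply/eqP; apply: span_ker; apply: span_repr.
Qed.

Fact quot_lift_is_linear : linear (quot_lift f0).
Proof.
move=> a p q; rewrite -(qprojK p) -(qprojK q) -linearP !quot_liftE.
exact: linearP.
Qed.

HB.instance Definition _ := GRing.isLinear.Build R (quot S) N *:%R
  (quot_lift f0) quot_lift_is_linear.

End QuotientLift.

Section Free.
Variables (R : pzRingType) (X : choiceType).

Definition finsupp : {pred X -> R^o} :=
  fun f => `[< finite_set [set x | f x != 0] >].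

Fact finsupp_submod_closed : submod_closed finsupp.
Proof.
split=> [|a f g /asboolP Ff /asboolP Fg]; apply/asboolP.
  by apply: (sub_finite_set _ (finite_set0 X)) => x /=; rewrite eqxx.
apply: (@sub_finite_set _ _ ([set x | f x != 0] `|` [set x | g x != 0])).
  move=> x /=; apply: contraPP => /not_orP[].
  move=> /negP/negPn/eqP fx /negP/negPn/eqP gx; apply/negP/negPn/eqP.
  by rewrite -[LHS]/(a *: f x + g x) fx gx scaler0 addr0.
by rewrite finite_setU.
Qed.

HB.instance Definition _ := GRing.isSubmodClosed.Build R (X -> R^o) finsupp
  finsupp_submod_closed.

(* the free R-module on X: finitely supported functions X -> R *)
Record free := Free { free_val :> X -> R^o; _ : free_val \in finsupp }.
HB.instance Definition _ := [isSub for free_val].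
HB.instance Definition _ := [Choice of free by <:].
HB.instance Definition _ := [SubChoice_isSubLmodule of free by <:].

End Free.

Section FreeLift.
Variables (R : pzRingType) (X : choiceType).

Fact fgen_finsupp (x : X) : (fun y => (y == x)%:R : R^o) \in @finsupp R X.
Proof.
apply/asboolP; apply: (sub_finite_set _ (finite_set1 x)) => y /=.
by case: (eqVneq y x) => // _; rewrite eqxx.
Qed.

Definition fgen (x : X) : free R X := Free (fgen_finsupp x).

Lemma free_addE (f g : free R X) x : (f + g) x = f x + g x.
Proof. by []. Qed.

Lemma free_scaleE a (f : free R X) x : (a *: f) x = a * f x.
Proof. by []. Qed.

Lemma free_seq (f : free R X) :
  exists2 r : seq X, uniq r & forall x, x \notin r -> f x = 0.
Proof.
case: f => f /= /asboolP /finite_seqP[s sE]; exists (undup s).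
  exact: undup_uniq.
move=> x; rewrite mem_undup => xs; apply/eqP/negPn/negP => fx.
have : [set x | f x != 0] x by [].
by rewrite sE /= (negPf xs).
Qed.

Variables (N : lmodType R) (h : X -> N).

Definition free_lift (f : free R X) : N :=
  \sum_(x \in [set: X]) (f x : R) *: h x.

Lemma free_liftE (f : free R X) r : uniq r ->
  (forall x, x \notin r -> f x = 0) ->
  free_lift f = \sum_(x <- r) (f x : R) *: h x.
Proof.
move=> ur fr; rewrite /free_lift (fsbigE r) //=.
  by apply: eq_bigl => x; rewrite in_setT.
by move=> x _ /fr ->; rewrite scale0r.
Qed.

Lemma free_lift_gen x : free_lift (fgen x) = h x.
Proof.
rewrite (@free_liftE _ [:: x]) //.
  by rewrite big_seq1 /= eqxx scale1r.
by move=> y; rewrite inE /= => /negPf ->.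
Qed.

Fact free_lift_is_linear : linear free_lift.
Proof.
move=> a f g.
have [r ur fr] := free_seq f; have [s us gs] := free_seq g.
have nin x : x \notin undup (r ++ s) -> (x \notin r) && (x \notin s).
  by rewrite mem_undup mem_cat negb_or.
rewrite !(@free_liftE _ (undup (r ++ s)) (undup_uniq _)).
- rewrite scaler_sumr -big_split; apply: eq_bigr => x _ /=.
  by rewrite scalerA -scalerDl.
- by move=> x /nin /andP[_ /gs].
- by move=> x /nin /andP[/fr].
- move=> x /nin /andP[/fr fx /gs gx].
  by rewrite free_addE free_scaleE fx gx mulr0 addr0.
Qed.

HB.instance Definition _ := GRing.isLinear.Build R (free R X) N *:%R
  free_lift free_lift_is_linear.

End FreeLift.

Lemma free_expand (R : pzRingType) (X : choiceType) (f : free R X) :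
  f = free_lift (@fgen R X) f.
Proof.
have [r ur fr] := free_seq f; rewrite (free_liftE _ ur fr).
apply/val_inj/funext => x.
have E (s : seq X) : val (\sum_(y <- s) (f y : R) *: fgen R y) x =
    \sum_(y <- s) f y * (x == y)%:R.
  by elim: s => [|y s IH]; rewrite ?big_nil // !big_cons -IH.
rewrite E; have [xr|xr] := boolP (x \in r); last first.
  rewrite [LHS]fr // big1_seq // => y /andP[_ yr].
  by case: eqVneq xr => [->|_ _]; rewrite ?yr ?mulr0.
rewrite (bigD1_seq x) //= eqxx mulr1 big1 ?addr0 // => y /negPf yx.
by rewrite eq_sym yx mulr0.
Qed.

Section Tensor.
Variables (R : comPzRingType) (A B : lmodType R).
Local Notation e a b := (fgen R (a, b)).

Inductive tensor_rel : set (free R (A * B)%type) :=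
| Tensor_addl a a' b : tensor_rel (e (a + a') b - e a b - e a' b)
| Tensor_addr a b b' : tensor_rel (e a (b + b') - e a b - e a b')
| Tensor_scalel r a b : tensor_rel (e (r *: a) b - r *: e a b)
| Tensor_scaler r a b : tensor_rel (e a (r *: b) - r *: e a b).

Definition tensor := quot tensor_rel.
HB.instance Definition _ := GRing.Lmodule.on tensor.

Definition tens (a : A) (b : B) : tensor := qproj tensor_rel (e a b).

End Tensor.

Section I2.
Variable R : comPzRingType.

Definition in_I2 : {pred R^o} :=
  fun t => `[< span (range (fun r : R^o => r ^+ 2 - r)) t >].

Fact in_I2_submod_closed : submod_closed in_I2.
Proof.
split=> [|a u v /asboolP Iu /asboolP Iv]; apply/asboolP.
  exact: span0.
exact: spanP.
Qed.

HB.instance Definition _ := GRing.isSubmodClosed.Build R R^o in_I2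
  in_I2_submod_closed.

Record I2 := MkI2 { I2_val : R^o; _ : I2_val \in in_I2 }.
HB.instance Definition _ := [isSub for I2_val].
HB.instance Definition _ := [Choice of I2 by <:].
HB.instance Definition _ := [SubChoice_isSubLmodule of I2 by <:].

Fact I2gen_subproof (r : R) : (r ^+ 2 - r : R^o) \in in_I2.
Proof. by apply/asboolP; apply: sub_span; exists r. Qed.

Definition I2gen (r : R) : I2 := MkI2 (I2gen_subproof r).

End I2.

Section P2.
Variables (R : comPzRingType) (M : lmodType R).
Local Notation e x := (fgen R x).

Inductive P2_rel : set (free R M) :=
| P2_rel_add x y z : P2_rel
    (e (x + y + z) - e (x + y) - e (y + z) - e (x + z) + e x + e y + e z)
| P2_rel_lin r s x y : P2_rel
    (e (r *: x + s *: y) - e (r *: x) - e (s *: y)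
     - (r * s) *: e (x + y) + (r * s) *: e x + (r * s) *: e y)
| P2_rel_scale r s x : P2_rel
    (e ((r * s) *: x) - r ^+ 2 *: e (s *: x) - s *: e (r *: x)
     + (r ^+ 2 * s) *: e x).

Definition P2 := quot P2_rel.
HB.instance Definition _ := GRing.Lmodule.on P2.

Definition p (x : M) : P2 := qproj P2_rel (e x).

End P2.

Section Gamma2.
Variables (R : comPzRingType) (M : lmodType R).
Local Notation e2 x := (fgen R (inl x : M + M * M)).
Local Notation e11 x y := (fgen R (inr (x, y) : M + M * M)).

(* The generator inl x stands for gamma_2(x), and inr (x, y) for the symbol
   gamma_1(x) gamma_1(y). *)
Inductive Gamma2_rel : set (free R (M + M * M)%type) :=
| Gamma2_rel_addl x x' y :
    Gamma2_rel (e11 (x + x') y - e11 x y - e11 x' y)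
| Gamma2_rel_addr x y y' :
    Gamma2_rel (e11 x (y + y') - e11 x y - e11 x y')
| Gamma2_rel_scalel r x y : Gamma2_rel (e11 (r *: x) y - r *: e11 x y)
| Gamma2_rel_scaler r x y : Gamma2_rel (e11 x (r *: y) - r *: e11 x y)
| Gamma2_rel_add x y : Gamma2_rel (e2 (x + y) - (e2 x + e2 y + e11 x y))
| Gamma2_rel_scale r x : Gamma2_rel (e2 (r *: x) - r ^+ 2 *: e2 x).

Definition Gamma2 := quot Gamma2_rel.
HB.instance Definition _ := GRing.Lmodule.on Gamma2.

Definition gamma2 (x : M) : Gamma2 := qproj Gamma2_rel (e2 x).
Definition gamma11 (x y : M) : Gamma2 := qproj Gamma2_rel (e11 x y).

End Gamma2.

(* linear map out of a presented module, from the images of the generators *)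
Section PresentedLift.
Variables (R : pzRingType) (X : choiceType) (S : set (free R X)).
Variables (N : lmodType R).

Definition pres_lift (h : X -> N)
    (h0 : forall v, S v -> free_lift h v = 0) : {linear quot S -> N} :=
  quot_lift h0.

Lemma pres_liftE h h0 x : @pres_lift h h0 (qproj S (fgen R x)) = h x.
Proof. exact: etrans (quot_liftE _ _) (free_lift_gen _ _). Qed.

Lemma pres_linear_eq (f g : {linear quot S -> N}) :
  (forall x, f (qproj S (fgen R x)) = g (qproj S (fgen R x))) -> f =1 g.
Proof.
move=> fg q; rewrite -(qprojK q) [repr q]free_expand.
have [r ur Hr] := free_seq (repr q); rewrite (free_liftE _ ur Hr).
by rewrite !linear_sum; apply: eq_bigr => x _; rewrite !linearZ_LR /= fg.
Qed.

End PresentedLift.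

Section Relations.
Variables (R : comPzRingType).

Lemma qproj_rel (V : lmodType R) (S : set V) u v :
  S (u - v) -> qproj S u = qproj S v.
Proof. by move=> Suv; apply/qproj_eq; apply: sub_span. Qed.

Lemma qproj_rel0 (V : lmodType R) (S : set V) v : S v -> qproj S v = 0.
Proof.
move=> Sv; rewrite -[RHS](linear0 (qproj S)); apply: qproj_rel.
by rewrite subr0.
Qed.

Section TensorTheory.
Variables A B : lmodType R.
Implicit Types (a : A) (b : B).

Lemma tensDl a a' b : tens (a + a') b = tens a b + tens a' b.
Proof.
rewrite /tens -linearD; apply: qproj_rel.
by rewrite opprD addrA; exact: Tensor_addl.
Qed.

Lemma tensDr a b b' : tens a (b + b') = tens a b + tens a b'.
Proof.
rewrite /tens -linearD; apply: qproj_rel.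
by rewrite opprD addrA; exact: Tensor_addr.
Qed.

Lemma tensZl r a b : tens (r *: a) b = r *: tens a b.
Proof. by rewrite /tens -linearZ_LR; apply: qproj_rel; exact: Tensor_scalel. Qed.

Lemma tensZr r a b : tens a (r *: b) = r *: tens a b.
Proof. by rewrite /tens -linearZ_LR; apply: qproj_rel; exact: Tensor_scaler. Qed.

End TensorTheory.

Variable M : lmodType R.
Implicit Types x y z : M.

Lemma p_add x y z :
  p (x + y + z) - p (x + y) - p (y + z) - p (x + z) + p x + p y + p z = 0.
Proof. by rewrite -(qproj_rel0 (P2_rel_add x y z)) !(linearB, linearD). Qed.

Lemma p_lin r s x y :
  p (r *: x + s *: y) - p (r *: x) - p (s *: y)
    - (r * s) *: p (x + y) + (r * s) *: p x + (r * s) *: p y = 0.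
Proof.
by rewrite -(qproj_rel0 (P2_rel_lin r s x y)) !(linearB, linearD) !linearZ_LR.
Qed.

Lemma p_scale r s x :
  p ((r * s) *: x) - r ^+ 2 *: p (s *: x) - s *: p (r *: x)
    + (r ^+ 2 * s) *: p x = 0.
Proof.
by rewrite -(qproj_rel0 (P2_rel_scale r s x)) !(linearB, linearD) !linearZ_LR.
Qed.

Lemma gamma11Dl x x' y : gamma11 (x + x') y = gamma11 x y + gamma11 x' y.
Proof.
rewrite /gamma11 -linearD; apply: qproj_rel.
by rewrite opprD addrA; exact: Gamma2_rel_addl.
Qed.

Lemma gamma11Dr x y y' : gamma11 x (y + y') = gamma11 x y + gamma11 x y'.
Proof.
rewrite /gamma11 -linearD; apply: qproj_rel.
by rewrite opprD addrA; exact: Gamma2_rel_addr.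
Qed.

Lemma gamma11Zl r x y : gamma11 (r *: x) y = r *: gamma11 x y.
Proof. by rewrite /gamma11 -linearZ_LR; apply: qproj_rel; exact: Gamma2_rel_scalel. Qed.

Lemma gamma11Zr r x y : gamma11 x (r *: y) = r *: gamma11 x y.
Proof. by rewrite /gamma11 -linearZ_LR; apply: qproj_rel; exact: Gamma2_rel_scaler. Qed.

Lemma gamma2D x y : gamma2 (x + y) = gamma2 x + gamma2 y + gamma11 x y.
Proof.
apply: subr0_eq.
by rewrite -(qproj_rel0 (Gamma2_rel_add x y)) linearB !linearD.
Qed.

Lemma gamma2Z r x : gamma2 (r *: x) = r ^+ 2 *: gamma2 x.
Proof. by rewrite /gamma2 -linearZ_LR; apply: qproj_rel; exact: Gamma2_rel_scale. Qed.


Fact g2_subproof v : P2_rel v -> free_lift (@gamma2 R M) v = 0.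
Proof.
case=> [x y z|r s x y|r s x];
  rewrite !(linearB, linearD) ?linearZ_LR /= !free_lift_gen.
- rewrite !gamma2D gamma11Dl !opprD !addrA.
  rewrite [LHS](ACl ((1*7)*(2*8)*(3*9)*(4*11)*(5*15)*(6*12)*(16*13)*(17*10)
    *(18*14))) /=.
  by rewrite !subrr !addr0.
- rewrite !gamma2D gamma11Zl gamma11Zr scalerA !gamma2Z.
  rewrite scalerN !scalerDr !opprD !addrA.
  rewrite [LHS](ACl ((1*4)*(2*5)*(3*8)*(9*6)*(10*7))) /=.
  by rewrite !subrr !addr0.
- rewrite !gamma2Z !scalerN !scalerA -!scalerBl -scalerDl.
  by rewrite exprMn subrr sub0r [s * _]mulrC addNr scale0r.
Qed.

Definition g2 : {linear P2 M -> Gamma2 M} := pres_lift g2_subproof.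

Lemma g2E x : g2 (p x) = gamma2 x.
Proof. exact: pres_liftE. Qed.

Lemma g2_unique (g : {linear P2 M -> Gamma2 M}) :
  (forall x, g (p x) = gamma2 x) -> g =1 g2.
Proof. by move=> gE; apply: pres_linear_eq => x; rewrite [LHS]gE [RHS]g2E. Qed.


Section ChiWellDefined.
Variables (N : lmodType R) (f : R -> N).
Hypothesis fD : forall r s, f (r + s) = f r + f s + (r * s) *: f 2%:R.
Hypothesis fM : forall r s, f (r * s) = r ^+ 2 *: f s + s *: f r.

Let f1 : f 1 = 0.
Proof.
by have /esym/eqP := fM 1 1; rewrite mulr1 expr1n !scale1r -subr_eq0 addrK
  => /eqP.
Qed.

Let f0 : f 0 = 0.
Proof. by rewrite -[X in f X](mulr0 0) fM expr2 mul0r !scale0r addr0. Qed.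

Let fN1 : f (- 1) = f 2%:R.
Proof.
have := fD 1 (- 1); rewrite subrr f0 f1 add0r mulrN mulr1 scaleN1r.
by move/esym/subr0_eq.
Qed.

Let fN r : f (- r) = f r + r *: f 2%:R.
Proof. by rewrite -mulN1r fM sqrrN expr1n scale1r fN1. Qed.

Let fC r s : (s ^+ 2 - s) *: f r = (r ^+ 2 - r) *: f s.
Proof.
have E : r ^+ 2 *: f s + s *: f r = s ^+ 2 *: f r + r *: f s.
  by rewrite -!fM mulrC.
apply/eqP; rewrite eq_sym !scalerBl subr_eq addrAC eq_sym subr_eq.
by rewrite E.
Qed.

Let f2 r : (r ^+ 2 - r) *: f 2%:R = 2%:R *: f r.
Proof. by rewrite -fC; congr (_ *: _); ring. Qed.

Let fI r : f (r ^+ 2 - r) = (r ^+ 2 - r - 1) *: f r.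
Proof.
have E : (r - r ^+ 3) *: f 2%:R = (- (r + 1) * 2%:R) *: f r.
  by rewrite -scalerA -f2 scalerA; congr (_ *: _); ring.
have fr2 : f (r ^+ 2) = r ^+ 2 *: f r + r *: f r by rewrite {1}expr2 fM.
transitivity ((r ^+ 2 + r + 1) *: f r + (r - r ^+ 3) *: f 2%:R).
  rewrite fD fN fr2; have -> : r ^+ 2 * - r = - r ^+ 3 by ring.
  by rewrite !scalerDl scale1r !addrA.
by rewrite E -scalerDl; congr (_ *: _); ring.
Qed.

Let fIM a r : f (a * (r ^+ 2 - r)) = (a ^+ 2 * (r ^+ 2 - r) - a) *: f r.
Proof.
by rewrite fM fI fC scalerA -scalerDl; congr (_ *: _); ring.
Qed.

Definition I2sum (l : seq (R * R)) : R :=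
  \sum_(ar <- l) ar.1 * (ar.2 ^+ 2 - ar.2).

Definition chisum (l : seq (R * R)) : N := \sum_(ar <- l) ar.1 *: f ar.2.

Let chisumC r l : (r ^+ 2 - r) *: chisum l = I2sum l *: f r.
Proof.
rewrite scaler_sumr scaler_suml; apply: eq_bigr => ar _.
by rewrite scalerA mulrC -scalerA -fC scalerA.
Qed.

(* chisumE shows that I2sum l = 0 implies chisum l = 0, so that chisum l
   depends only on I2sum l (chisum_wd). *)
Lemma chisumE l : chisum l = I2sum l *: chisum l - f (I2sum l).
Proof.
rewrite /I2sum; elim: l => [|[a r] l IH].
  by rewrite /chisum !big_nil scale0r f0 subr0.
rewrite /chisum !big_cons /= -/(chisum l) -/(I2sum l).
set A := chisum l; set U := I2sum l.
have Ef : U *: f 2%:R = 2%:R *: A.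
  by rewrite -chisumC; congr (_ *: _); ring.
have uA : (a * (r ^+ 2 - r)) *: A = (a * U) *: f r.
  by rewrite -scalerA chisumC scalerA.
have uf : (a * (r ^+ 2 - r) * U) *: f 2%:R = (2%:R * (a * U)) *: f r.
  by rewrite -scalerA Ef scalerA [_ * 2%:R]mulrC -[LHS]scalerA uA scalerA.
have IHe : U *: A = A + f U by rewrite {2}[A]IH subrK.
rewrite fD fIM uf scalerDr (scalerDl A) uA IHe scalerA !opprD !addrA.
rewrite [RHS](ACl ((1*2*5*7)*3*(4*6))) /= subrr addr0 -!scaleNr -!scalerDl.
by congr (_ *: _ + _); ring.
Qed.

Lemma chisum_wd l l' : I2sum l = I2sum l' -> chisum l = chisum l'.
Proof.
have chisum0 k : I2sum k = 0 -> chisum k = 0.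
  by move=> k0; rewrite chisumE k0 scale0r f0 subr0.
pose m := [seq (- ar.1, ar.2) | ar <- l'].
have Im : I2sum (l ++ m) = I2sum l - I2sum l'.
  rewrite /I2sum big_cat big_map; congr (_ + _).
  by rewrite -sumrN; apply: eq_bigr => ar _; rewrite mulNr.
have cm : chisum (l ++ m) = chisum l - chisum l'.
  rewrite /chisum big_cat big_map; congr (_ + _).
  by rewrite -sumrN; apply: eq_bigr => ar _; rewrite scaleNr.
by move=> E; apply: subr0_eq; rewrite -cm chisum0 // Im E subrr.
Qed.

End ChiWellDefined.

Lemma in_I2P (t : I2 R) : exists l, I2_val t = I2sum l.
Proof.
case: t => t /= /asboolP; move: t.
apply: span_min => [|t [r _ <-]]; last first.
  by exists [:: (1, r)]; rewrite /I2sum big_seq1 mul1r.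
split=> [|a u v [l ->] [l' ->]]; first by exists [::]; rewrite /I2sum big_nil.
exists ([seq (a * ar.1, ar.2) | ar <- l] ++ l').
rewrite /I2sum big_cat big_map; congr (_ + _).
rewrite [LHS]mulr_sumr; apply: eq_bigr => ar _; exact: mulrA.
Qed.

Definition I2coefs (t : I2 R) : seq (R * R) := projT1 (cid (in_I2P t)).

Lemma I2coefsE t : I2sum (I2coefs t) = I2_val t.
Proof. by rewrite /I2coefs; case: cid. Qed.

Definition pdefect (x : M) (r : R) : P2 M := p (r *: x) - r ^+ 2 *: p x.

Lemma pdefectD x r s : pdefect x (r + s) =
  pdefect x r + pdefect x s + (r * s) *: pdefect x 2%:R.
Proof.
have /eqP := p_lin r s x x.
rewrite -!addrA addr_eq0 !opprD !opprK !addrA /pdefect => /eqP.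
rewrite -scalerDl => ->; rewrite (_ : 2%:R *: x = x + x); last first.
  by rewrite scalerDl scale1r.
rewrite scalerBr scalerA !addrA.
rewrite [LHS](ACl (1*2*3*(4*5*6))) [RHS](ACl (1*3*5*(2*4*6))) /=.
by congr (_ + _); rewrite -!scaleNr -!scalerDl; congr (_ *: _); ring.
Qed.

Lemma pdefectM x r s :
  pdefect x (r * s) = r ^+ 2 *: pdefect x s + s *: pdefect x r.
Proof.
have /eqP := p_scale r s x.
rewrite -!addrA addr_eq0 !opprD !opprK !addrA /pdefect => /eqP ->.
rewrite !scalerBr !scalerA !addrA.
rewrite [LHS](ACl (1*2*(3*4))) [RHS](ACl (1*3*(2*4))) /=.
by congr (_ + _); rewrite -!scaleNr -!scalerDl; congr (_ *: _); ring.
Qed.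

Lemma pdefect_addx x y r : pdefect (x + y) r = pdefect x r + pdefect y r.
Proof.
have /eqP := p_lin r r x y.
rewrite -!addrA addr_eq0 !opprD !opprK !addrA /pdefect scalerDr => /eqP ->.
by rewrite -!expr2 [LHS](ACl ((1*4*2*5)*(3*6))) /= subrr addr0.
Qed.

Lemma pdefect_scalex s x r : pdefect (s *: x) r = s *: pdefect x r.
Proof.
have /eqP := p_scale r s x.
rewrite -!addrA addr_eq0 !opprD !opprK !addrA /pdefect scalerA => /eqP ->.
rewrite [LHS](ACl ((1*4)*2*3)) /= subrr add0r scalerBr scalerA.
by rewrite [s * _]mulrC.
Qed.

(* value of chi on the pure tensor of t and x; by chi_preE any expression of t
   as a combination of elements r^2 - r may be used *)
Definition chi_pre (u : I2 R * M) : P2 M :=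
  chisum (pdefect u.2) (I2coefs u.1).

Lemma chi_preE t x l : I2_val t = I2sum l ->
  chi_pre (t, x) = chisum (pdefect x) l.
Proof.
move=> tl; apply: chisum_wd => [r s|r s|].
- exact: pdefectD.
- exact: pdefectM.
- by rewrite I2coefsE.
Qed.

Fact chi_subproof v : tensor_rel v -> free_lift chi_pre v = 0.
Proof.
case=> [t t' x|t x x'|a t x|a t x];
  rewrite !(linearB, linearD) ?linearZ_LR /= !free_lift_gen.
- rewrite (@chi_preE _ _ (I2coefs t ++ I2coefs t')); last first.
    by rewrite /I2sum big_cat -!/(I2sum _) !I2coefsE.
  by rewrite /chi_pre /= /chisum big_cat /= addrAC addrK subrr.
- rewrite /chi_pre /chisum /= -!sumrB big1 // => ar _.
  by rewrite pdefect_addx scalerDr addrAC addrK subrr.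
- rewrite (@chi_preE _ _ [seq (a * ar.1, ar.2) | ar <- I2coefs t]).
    rewrite scalerN /chi_pre /chisum /= big_map scaler_sumr -sumrB big1 // => ar _ /=.
    by rewrite scalerA subrr.
  rewrite -[LHS]/(a * I2_val t) -{1}(I2coefsE t) /I2sum big_map mulr_sumr.
  by apply: eq_bigr => ar _; rewrite mulrA.
- rewrite scalerN /chi_pre /chisum /= scaler_sumr -sumrB big1 // => ar _.
  by rewrite pdefect_scalex !scalerA mulrC subrr.
Qed.

Definition chi : {linear tensor (I2 R) M -> P2 M} := pres_lift chi_subproof.

Lemma chiE r x : chi (tens (I2gen r) x) = p (r *: x) - r ^+ 2 *: p x.
Proof.
apply: etrans (pres_liftE _ _) _; rewrite (@chi_preE _ _ [:: (1, r)]).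
  by rewrite /chisum big_seq1 scale1r.
by rewrite /I2sum big_seq1 mul1r.
Qed.

Lemma chi_unique (g : {linear tensor (I2 R) M -> P2 M}) :
  (forall r x, g (tens (I2gen r) x) = p (r *: x) - r ^+ 2 *: p x) -> g =1 chi.
Proof.
move=> gE; apply: pres_linear_eq => -[t x]; rewrite -/(tens t x).
have [l tl] := in_I2P t.
have -> : t = \sum_(ar <- l) ar.1 *: I2gen ar.2.
  apply: val_inj; rewrite /= tl.
  by elim: (l) => [|ar k IH]; rewrite /I2sum ?big_nil // !big_cons -/(I2sum k) IH.
have E : tens (\sum_(ar <- l) ar.1 *: I2gen ar.2) x =
    \sum_(ar <- l) ar.1 *: tens (I2gen ar.2) x.
  elim: (l) => [|ar k IH]; last by rewrite !big_cons tensDl tensZl IH.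
  by rewrite !big_nil -(scale0r (0 : I2 R)) tensZl scale0r.
by rewrite E !linear_sum; apply: eq_bigr => ar _; rewrite !linearZ_LR chiE gE.
Qed.

End Relations.

Arguments chi {R} M.
Arguments g2 {R} M.

Definition exact_at (A : Type) (B C : zmodType) (f : A -> B) (g : B -> C) :=
  forall y, g y = 0 <-> exists x, f x = y.

(* Main.v *)
Require Import Defs.
From mathcomp Require Import all_boot all_algebra.
From mathcomp Require Import boolp classical_sets.

(** The classes of the elements [p x] in the cokernel of [chi] satisfy the
    relations that define [Gamma2 M], with the polarization
    [p (x + y) - p x - p y] in the role of [gamma11 x y].  Indeed this
    polarization is already bilinear in [P2 M]: additivity is the first relation
    on [p], and homogeneity is the second one with one of the two scalars equal
    to 1 ([polarDl], [polarZl]).  The only relation that fails in [P2 M] is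
    [p (r *: x) = r ^+ 2 *: p x], and [chi] takes the defect
    [p (r *: x) - r ^+ 2 *: p x] as a value ([chiE]).  So there is a linear map
    [coker_of_gamma] from [Gamma2 M] to the cokernel of [chi] sending [gamma2 x]
    to the class of [p x].  Composed with [g2] it is the projection of [P2 M]
    onto the cokernel, hence the kernel of [g2] lies in the image of [chi].  The
    converse inclusion says that [gamma2] is homogeneous of degree 2, and [g2]
    is onto because [gamma11 x y] is the polarization of [gamma2]. *)

Set Implicit Arguments.
Unset Strict Implicit.
Unset Printing Implicit Defensive.
Import GRing.Theory.
Local Open Scope classical_set_scope.
Local Open Scope ring_scope.

(** The quotient by the range of [f], which is already a submodule, is the
    cokernel of [f]. *)
Lemma qproj_range_eq0 (R : comPzRingType) (V W : lmodType R) (f : {linear V -> W})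
    (w : W) :
  qproj (range f) w = 0 <-> exists v, f v = w.
Proof.
split=> [|[v <-]]; last by apply: qproj_rel0; exists v.
rewrite -(linear0 (qproj (range f))) => /qproj_eq; rewrite subr0.
move: w; apply: span_min => [|w [v _ <-]]; last by exists v.
split=> [|a u v [u' <-] [v' <-]]; first by exists 0; rewrite linear0.
by exists (a *: u' + v'); rewrite linearP.
Qed.

Section Polarization.
Variables (R : comPzRingType) (M : lmodType R).
Implicit Types (x y z : M) (r : R).

Definition polar x y : P2 M := p (x + y) - p x - p y.

Lemma pD_polar x y : p x + p y + polar x y = p (x + y).
Proof. by rewrite /polar -(addrA (p (x + y))) -opprD [LHS]addrC subrK. Qed.

Lemma polarC x y : polar x y = polar y x.
Proof. by rewrite /polar [x + y]addrC addrAC. Qed.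

Lemma polarDl x y z : polar (x + y) z = polar x z + polar y z.
Proof.
apply: subr0_eq; rewrite -[RHS](p_add x y z) /polar !opprD !opprK !addrA.
by rewrite [LHS](ACl (1*2*7*4*5*8*9*6*3)) /= addrK.
Qed.

Lemma polarZl r x y : polar (r *: x) y = r *: polar x y.
Proof.
apply: subr0_eq; rewrite -[RHS](p_lin r 1 x y) /polar scale1r mulr1.
by rewrite !scalerBr !opprD !opprK !addrA.
Qed.

Lemma polarDr x y z : polar x (y + z) = polar x y + polar x z.
Proof. by rewrite polarC polarDl !(polarC x). Qed.

Lemma polarZr r x y : polar x (r *: y) = r *: polar x y.
Proof. by rewrite polarC polarZl polarC. Qed.

Lemma g2_polar x y : g2 M (polar x y) = gamma11 x y.
Proof. by rewrite /polar !linearB !g2E gamma2D -addrA -opprD [LHS]addrC addKr. Qed.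

End Polarization.

Section Exactness.
Variables (R : comPzRingType) (M : lmodType R).

Definition coker_gen (u : M + M * M) : quot (range (chi M)) :=
  qproj _ (match u with inl x => p x | inr (x, y) => polar x y end).

(** Every relation but the homogeneity of [gamma2] comes from an identity in
    [P2 M]; that last one holds modulo a value of [chi] on a pure tensor. *)
Fact coker_gen_rel v : @Gamma2_rel R M v -> free_lift coker_gen v = 0.
Proof.
case=> [x x' y|x y y'|r x y|r x y|x y|r x];
  rewrite !(linearB, linearD) ?linearZ_LR /= !free_lift_gen /coker_gen.
- by rewrite polarDl linearD addrAC addrK subrr.
- by rewrite polarDr linearD addrAC addrK subrr.
- by rewrite scalerN polarZl linearZ_LR subrr.
- by rewrite scalerN polarZr linearZ_LR subrr.
- by rewrite -pD_polar !linearD /= -!opprD subrr.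
- rewrite scalerN -linearZ_LR -[LHS](linearB (qproj _)).
  apply: (proj2 (qproj_range_eq0 (chi M) _)).
  by exists (tens (I2gen r) x); rewrite chiE.
Qed.

Definition coker_of_gamma : {linear Gamma2 M -> quot (range (chi M))} :=
  pres_lift coker_gen_rel.

(** This factorization of the projection through [g2] bounds the kernel of [g2]
    by the range of [chi]. *)
Lemma coker_of_gamma_g2 y : coker_of_gamma (g2 M y) = qproj (range (chi M)) y.
Proof.
rewrite -[LHS]/((coker_of_gamma \o g2 M) y); move: y.
apply: pres_linear_eq => x; apply: etrans (congr1 coker_of_gamma (g2E x)) _.
exact: pres_liftE.
Qed.

Lemma g2_pdefect (x : M) (r : R) : g2 M (pdefect x r) = 0.
Proof. by rewrite /pdefect linearB linearZ_LR !g2E gamma2Z subrr. Qed.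

Lemma g2_chi t : g2 M (chi M t) = 0.
Proof.
rewrite -[LHS]/((g2 M \o chi M) t) -[RHS]/((\0 : {linear _ -> _}) t).
move: t; apply: pres_linear_eq => -[t x].
(* On a pure tensor, chi is a combination of defects p (r *: x) - r ^+ 2 *: p x. *)
apply: etrans (congr1 (g2 M) (pres_liftE _ _)) _.
rewrite [LHS]linear_sum big1 // => ar _.
by rewrite linearZ_LR g2_pdefect scaler0.
Qed.

(** The projection onto the cokernel of [g2] is linear, so it vanishes as soon as
    it does on the generators of [Gamma2 M]. *)
Lemma g2_surjective (z : Gamma2 M) : exists y, g2 M y = z.
Proof.
apply/qproj_range_eq0; rewrite -[RHS]/((\0 : {linear _ -> _}) z).
move: z; apply: pres_linear_eq => -[x|[x y]];
  apply: (proj2 (qproj_range_eq0 (g2 M) _)).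
  by exists (p x); rewrite g2E.
by exists (polar x y); rewrite g2_polar.
Qed.

End Exactness.

(* chi and g2 are linear maps characterised by the lemmas chiE, chi_unique and
   g2E, g2_unique; exactness at Gamma2 M means that g2 is surjective. *)
Theorem proposition6p6 (R : comPzRingType) (M : lmodType R) :
  exact_at (chi M) (g2 M) /\ (forall z : Gamma2 M, exists y : P2 M, g2 M y = z).
Proof.
split=> [y|]; last exact: g2_surjective.
split=> [gy0|[t <-]]; last exact: g2_chi.
by apply/qproj_range_eq0; rewrite -coker_of_gamma_g2 gy0 linear0.
Qed.
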